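(* Let $\mathcal X$ be an open subset of $\mathbb R^p$ with its Borel $\sigma$-field, let $\mathcal P$ be a set of probability measures on $\mathcal X$ (the model), let $\mu \in \mathcal P$, and let $\psi : \mathcal P \to \mathrm H$ be a map (the parameter), where $\mathrm H \subseteq \mathbb R^q$. Let $n \ge 1$ and let $X_1,\dots,X_n$ be i.i.d. with law $\mu$. If $T = T(X_1,\dots,X_n)$ is an unbiased estimator of $\psi$ in the model $\mathcal P$, then for all $\nu \in \mathcal P \setminus \{\mu\}$, $$ \operatorname{var}(T) \ \geq \ \frac{(\psi(\mu) - \psi(\nu))(\psi(\mu) - \psi(\nu))^t}{(d(\mu,\nu) + 1)^n - 1}, $$ where $\operatorname{var}(T)$ is the variance (covariance matrix if $q>1$) of $T$ under $\mu^{\otimes n}$, and for $q>1$ the inequality is meant in the sense of quadratic forms, i.e. for all $a \in \mathbb R^q$, $\operatorname{var}(a^t T) \geq \dfrac{(a^t\psi(\mu) - a^t\psi(\nu))^2}{(d(\mu,\nu)+1)^n - 1}$.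
   Context: The quadratic divergence of $\nu$ with respect to $\mu$, for probability measures $\mu,\nu$ on $\mathcal X$, is $$ d(\mu,\nu) = \int_{\mathcal X} \left(1 - \frac{d\nu}{d\mu}\right)^2 d\mu \in [0,+\infty] \ \text{ if } \nu \ll \mu, \qquad d(\mu,\nu) = +\infty \ \text{ otherwise}. $$ Convention: $1/\infty = 0$, so the right-hand side of the inequality is $0$ when $d(\mu,\nu)=+\infty$. An estimator is a measurable map $T : \mathcal X^n \to \mathbb R^q$. It is unbiased for $\psi$ in the model $\mathcal P$ if for every $\nu \in \mathcal P$, $T$ is $\nu^{\otimes n}$-integrable and $\int T \, d\nu^{\otimes n} = \psi(\nu)$. The scalar variances $\operatorname{var}(a^tT)$ (and $\operatorname{var}(T)$ when $q=1$) take values in $[0,+\infty]$. No regularity condition is imposed on $\mathcal P$ or $\psi$. *)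

(* Defs.v *)
From HB Require Import structures.
From mathcomp Require Import all_boot all_order all_algebra.
From mathcomp Require Import all_classical all_reals all_analysis.

Set Implicit Arguments.
Unset Strict Implicit.
Unset Printing Implicit Defensive.

Import Order.TTheory GRing.Theory Num.Theory.
Import numFieldNormedType.Exports.

Local Open Scope classical_set_scope.
Local Open Scope ring_scope.

(* A subset of a topological space, as a space of its own with the induced
   topology. Measurable types are pointed, hence the nonemptiness argument. *)
Definition nonempty_subspace (U : topologicalType) (A : set U)
  (A0 : A !=set0) : Type := set_type A.

Section nonempty_subspace.
Context (U : topologicalType) (A : set U) (A0 : A !=set0).

HB.instance Definition _ := Topological.on (@nonempty_subspace U A A0).
HB.instance Definition _ := isPointed.Build (nonempty_subspace A0)
  (exist _ (sval (cid A0)) (mem_set (svalP (cid A0)))).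

End nonempty_subspace.

Notation borel U := (g_sigma_algebraType (@open U)).

Section power_probability.
Context d (S : measurableType d) (R : realType).
Local Open Scope ereal_scope.

Definition cons_pair n (x : S * n.-tuple S) : n.+1.-tuple S :=
  [tuple of x.1 :: x.2].

Lemma measurable_cons_pair n : measurable_fun setT (@cons_pair n).
Proof.
by apply: measurable_cons; [exact: measurable_fst|exact: measurable_snd].
Qed.

HB.instance Definition _ n :=
  isMeasurableFun.Build _ _ _ _ (@cons_pair n) (@measurable_cons_pair n).

Fixpoint power_probability (mu : probability S R) n :
    probability (n.-tuple S) R :=
  match n with
  | 0 => \d_([tuple] : 0.-tuple S)
  | m.+1 => distribution (mu \x power_probability mu m) (@cons_pair m)
  end.

Lemma power_probability_cylinder (mu : probability S R) n
    (A : 'I_n -> set S) : (forall i, measurable (A i)) ->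
  power_probability mu n [set t | forall i, A i (tnth t i)] =
  \prod_(i < n) mu (A i).
Proof.
elim: n A => [|n IHn] A mA /=.
  by rewrite big_ord0 diracE mem_set// => -[].
rewrite big_ord_recl -(IHn (A \o lift ord0)); last by move=> i; exact: mA.
rewrite /distribution/= /pushforward -product_measure1E//.
- congr (_ _); apply/seteqP; split => -[x t] /=.
    move=> h; split; first exact: (h ord0).
    by move=> i; have := h (lift ord0 i); rewrite tnthS.
  by move=> [Ax At] i; case: (unliftP ord0 i) => [j ->|->//]; rewrite tnthS; exact: At.
- rewrite [X in measurable X](_ : _ =
    \bigcap_(i in [set: 'I_n]) ((@tnth n S)^~ i @^-1` A (lift ord0 i))).
    apply: fin_bigcap_measurable => // i _.
    by rewrite -[X in measurable X]setTI; exact: measurable_tnth.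
  by apply/seteqP; split => t h i => [_|]; [exact: h|exact: (h i I)].
Qed.

End power_probability.

Section statistics.
Context d (S : measurableType d) (R : realType).
Local Open Scope ereal_scope.
Local Open Scope charge_scope.

Definition quadratic_divergence (mu nu : probability S R) : \bar R :=
  if pselect (nu `<< mu) then
    \int[mu]_x (1 - ('d (charge_of_finite_measure nu) '/d mu) x) ^+ 2
  else +oo.

(* Equality of measures. Leibniz equality in probability S R is finer: a measure
   is a function on all sets, with unconstrained values off the
   sigma-algebra. *)
Definition same_law (mu nu : probability S R) :=
  forall A, measurable A -> mu A = nu A.

Definition is_estimator n q (T : n.-tuple S -> 'cV[R]_q) :=
  measurable_fun setT (T : n.-tuple S -> borel 'cV[R]_q).

(* The integral of T is taken coordinatewise. *)
Definition unbiased (P : set (probability S R)) q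
    (psi : probability S R -> 'cV[R]_q) n (T : n.-tuple S -> 'cV[R]_q) :=
  forall nu, P nu -> forall i : 'I_q,
    (power_probability nu n).-integrable setT (fun x => (T x i ord0)%:E) /\
    \int[power_probability nu n]_x (T x i ord0)%:E = (psi nu i ord0)%:E.

End statistics.

(* Main.v *)
(* If nu << mu has density r, then nu^n has density L = prod_i r(x_i) with respect
   to mu^n, and (L - 1) has second moment (int r^2 dmu)^n - 1 = (d(mu, nu) + 1)^n - 1
   under mu^n. For an unbiased estimator Y, E_mu[(Y - E_mu Y) (L - 1)] is the
   difference E_nu Y - E_mu Y, and the Cauchy-Schwarz inequality gives the bound. *)
Require Import Defs.
From mathcomp Require Import all_boot all_order all_algebra.
From mathcomp Require Import all_classical all_reals all_analysis measurable_realfun.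
From mathcomp Require Import ring.

Set Implicit Arguments.
Unset Strict Implicit.

Import Order.TTheory GRing.Theory Num.Theory.
Import numFieldNormedType.Exports.

Local Open Scope classical_set_scope.
Local Open Scope ring_scope.
Local Open Scope ereal_scope.

(** * Densities, and the variance bound for a single observation *)

Section density.
Context d (S : measurableType d) (R : realType).
Implicit Types mu nu : probability S R.

(** Since [L] is nonnegative, the positive and negative parts of [g * L] are those of [g] times [L],
    so the identity for nonnegative functions passes to integrable ones. *)
Lemma integral_density mu nu (L : S -> R) :
  measurable_fun setT L -> (forall x, 0 <= L x)%R ->
  (forall g : S -> \bar R, measurable_fun setT g -> (forall x, 0 <= g x) ->
    \int[nu]_x g x = \int[mu]_x (g x * (L x)%:E)) ->
  forall g : S -> \bar R, nu.-integrable setT g ->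
  mu.-integrable setT (fun x => g x * (L x)%:E) /\
  \int[mu]_x (g x * (L x)%:E) = \int[nu]_x g x.
Proof.
move=> mL L0 nuE g /integrableP[mg ig]; split.
  apply/integrableP; split.
    by apply: emeasurable_funM => //; exact/measurable_EFinP.
  move: ig; rewrite nuE//; last exact: measurableT_comp.
  by under eq_integral do rewrite -(gee0_abs (_ : 0 <= (L _)%:E)) ?lee_fin// -abseM.
rewrite integralE [RHS]integralE; congr (_ - _).
  rewrite nuE//; last exact: measurable_funepos.
  by apply: eq_integral => x _; rewrite !funeposE maxe_pMl ?lee_fin// mul0e.
rewrite nuE//; last exact: measurable_funeneg.
by apply: eq_integral => x _; rewrite !funenegE maxe_pMl ?lee_fin// mul0e mulNe.
Qed.

Lemma integral_probability_cst mu (c : R) : \int[mu]_x c%:E = c%:E.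
Proof. by rewrite -[RHS](expectation_cst mu c) unlock. Qed.

Lemma density_integral1 mu nu (L : S -> R) :
  measurable_fun setT L -> (forall x, 0 <= L x)%R ->
  (forall g : S -> \bar R, measurable_fun setT g -> (forall x, 0 <= g x) ->
    \int[nu]_x g x = \int[mu]_x (g x * (L x)%:E)) ->
  mu.-integrable setT (fun x => (L x)%:E) /\ \int[mu]_x (L x)%:E = 1.
Proof.
move=> mL L0 nuE; have [iL L1] :=
  integral_density mL L0 nuE (finite_measure_integrable_cst nu 1%R measurableT).
rewrite -(integral_probability_cst nu 1) -L1.
split; last by apply: eq_integral => x _; rewrite mul1e.
by apply: eq_integrable iL => // x _; rewrite mul1e.
Qed.

(* Integrate U^2 >= 2 s U V - s^2 V^2 with s = c / v. *)
Lemma second_moment_ge mu (U V : S -> R) (c v : R) :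
  (0 < v)%R -> measurable_fun setT U ->
  mu.-integrable setT (fun x => (U x * V x)%:E) ->
  \int[mu]_x (U x * V x)%:E = c%:E ->
  mu.-integrable setT (fun x => (V x ^+ 2)%:E) ->
  \int[mu]_x (V x ^+ 2)%:E = v%:E ->
  (c ^+ 2 / v)%:E <= \int[mu]_x (U x ^+ 2)%:E.
Proof.
move=> v0 mU iUV UVc iV Vv.
(* The second moment of [U] may be infinite; once it is finite, both sides of the pointwise
   inequality are integrable. *)
have [->|] := eqVneq (\int[mu]_x (U x ^+ 2)%:E) +oo; first exact: leey.
rewrite -ltey => Uoo.
have iU : mu.-integrable setT (fun x => (U x ^+ 2)%:E).
  apply/integrableP; split; first exact/measurable_EFinP/measurable_funX.
  by under eq_integral do rewrite gee0_abs ?lee_fin ?sqr_ge0//.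
have -> : (c ^+ 2 / v)%:E =
    \int[mu]_x ((2 * (c / v))%:E * (U x * V x)%:E +
                (- (c / v) ^+ 2)%:E * (V x ^+ 2)%:E).
  rewrite integralD//; [|exact: integrableZl|exact: integrableZl].
  rewrite !integralZl// UVc Vv -!EFinM -EFinD; congr EFin.
  by field; rewrite gt_eqF.
apply: le_integral => //.
- by apply: integrableD => //; exact: integrableZl.
- move=> x _; rewrite -!EFinM -EFinD lee_fin -subr_ge0.
  rewrite [leRHS](_ : _ = (U x - c / v * V x) ^+ 2)%R ?sqr_ge0//; ring.
Qed.

(** Passes between second moments about different points: from [r - 1] to [r] for one observation,
    and from the likelihood ratio [L] to [L - 1] for the sample. *)
Lemma integral_sqrB mu (X : S -> R) (c m v : R) :
  mu.-integrable setT (fun x => (X x)%:E) -> \int[mu]_x (X x)%:E = m%:E ->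
  mu.-integrable setT (fun x => (X x ^+ 2)%:E) ->
  \int[mu]_x (X x ^+ 2)%:E = v%:E ->
  mu.-integrable setT (fun x => ((X x - c) ^+ 2)%:E) /\
  \int[mu]_x ((X x - c) ^+ 2)%:E = (v - 2 * c * m + c ^+ 2)%:E.
Proof.
move=> iX Xm iX2 X2v.
have i1 := integrableZl measurableT (- (2 * c))%R iX.
have i2 := integrableD measurableT iX2 i1.
have ic := finite_measure_integrable_cst mu (c ^+ 2)%R measurableT.
have -> : (fun x => ((X x - c) ^+ 2)%:E) = (fun x =>
    (X x ^+ 2)%:E + (- (2 * c))%:E * (X x)%:E + (c ^+ 2)%:E).
  by apply/funext => x; rewrite -EFinM -!EFinD; congr EFin; ring.
split; first exact: integrableD.
rewrite integralD// integralD// X2v integralZl// Xm integral_probability_cst.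
by rewrite -EFinM -!EFinD mulNr.
Qed.

(** The divergence is written with the derivative of a charge, while the change of variables holds
    for the derivative of a sigma-finite measure. The two agree [mu]-almost everywhere, so the
    latter, made real by [fine], serves for both. *)
Lemma density_ex mu nu : nu `<< mu -> exists r : S -> R,
  [/\ measurable_fun setT r, (forall x, 0 <= r x)%R,
      (forall f : S -> \bar R, measurable_fun setT f -> (forall x, 0 <= f x) ->
        \int[nu]_x f x = \int[mu]_x (f x * (r x)%:E)) &
      quadratic_divergence mu nu = \int[mu]_x ((r x - 1) ^+ 2)%:E].
Proof.
move=> numu; pose f := Radon_Nikodym_SigmaFinite.f nu mu.
have f_fin x : f x \is a fin_num by exact: Radon_Nikodym_SigmaFinite.f_fin_num.
have mf : measurable_fun setT f.
  exact: (measurable_int mu) (Radon_Nikodym_SigmaFinite.f_integrable numu).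
have mr : measurable_fun setT (fine \o f).
  by apply: measurableT_comp => //; exact: fine_measurable.
exists (fine \o f); split => //.
- by move=> x /=; rewrite fine_ge0// Radon_Nikodym_SigmaFinite.f_ge0.
- move=> g mg g0; rewrite -(Radon_Nikodym_SigmaFinite.change_of_variables numu)//.
  by apply: eq_integral => x _; rewrite /= fineK.
- rewrite /quadratic_divergence; case: pselect => // numu'.
  pose g := Radon_Nikodym (charge_of_finite_measure nu) mu.
  have g_fin x : g x \is a fin_num by exact: Radon_Nikodym_fin_num.
  have mg : measurable_fun setT (fine \o g).
    apply: measurableT_comp; first exact: fine_measurable.
    apply: (measurable_int mu); exact: Radon_Nikodym_integrable.
  transitivity (\int[mu]_x (((fine \o g) x - 1) ^+ 2)%:E).
    apply: eq_integral => x _.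
    by rewrite -/(g x) -(fineK (g_fin x)) -EFinB -EFin_expe -sqrrN opprB.
  apply: ae_eq_integral => //.
  + by apply/measurable_EFinP/measurable_funX; exact: measurable_funB.
  + by apply/measurable_EFinP/measurable_funX; exact: measurable_funB.
  + apply: (ae_eq_comp (fun y => ((fine y - 1) ^+ 2)%:E)).
    exact/ae_eq_sym/ae_eq_Radon_Nikodym_SigmaFinite.
Qed.

(** Cauchy-Schwarz for [Y - m] and [L - 1]. The cross term is integrable because [Y] is integrable
    under both laws, so an infinite variance is covered too. *)
Lemma variance_ge mu nu (L Y : S -> R) (v : R) :
  measurable_fun setT L -> (forall x, 0 <= L x)%R ->
  (forall g : S -> \bar R, measurable_fun setT g -> (forall x, 0 <= g x) ->
    \int[nu]_x g x = \int[mu]_x (g x * (L x)%:E)) ->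
  mu.-integrable setT (fun x => ((L x - 1) ^+ 2)%:E) ->
  \int[mu]_x ((L x - 1) ^+ 2)%:E = v%:E -> (0 < v)%R ->
  mu.-integrable setT (EFin \o Y) -> nu.-integrable setT (EFin \o Y) ->
  ((fine 'E_mu[Y] - fine 'E_nu[Y]) ^+ 2 / v)%:E <= 'V_mu[Y].
Proof.
move=> mL L0 nuE iV Vv v0 iY iY'.
have mY : measurable_fun setT Y by apply/measurable_EFinP; exact: (measurable_int mu).
have fmu : 'E_mu[Y] \is a fin_num by rewrite unlock; exact: integrable_fin_num.
have fnu : 'E_nu[Y] \is a fin_num by rewrite unlock; exact: integrable_fin_num.
set m := fine 'E_mu[Y]; set m' := fine 'E_nu[Y].
have Ym : \int[mu]_x (Y x)%:E = m%:E by rewrite fineK// unlock.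
have Ym' : \int[nu]_x (Y x)%:E = m'%:E by rewrite fineK// unlock.
have [iYL YLm'] := integral_density mL L0 nuE iY'.
have [iL L1] := density_integral1 mL L0 nuE.
have -> : 'V_mu[Y] = \int[mu]_x ((Y x - m) ^+ 2)%:E.
  rewrite /variance covariance.unlock -/m expectation.unlock.
  by apply: eq_integral => x _; rewrite expr2.
(* The cross moment comes out as [m' - m], the opposite of the difference in the statement. *)
rewrite -sqrrN opprB.
(* Expanded into four separately integrable terms, with integrals [m'], [m], [m] and [m]. *)
have UVE x : ((Y x - m) * (L x - 1))%:E =
    ((Y x)%:E * (L x)%:E - (Y x)%:E) - (m%:E * (L x)%:E - m%:E).
  by rewrite -!EFinM -!EFinB; congr EFin; ring.
have imL := integrableZl measurableT m iL.
have im := finite_measure_integrable_cst mu m measurableT.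
apply: (second_moment_ge v0 _ _ _ iV Vv) => //.
- exact: measurable_funB.
- under eq_fun do rewrite UVE.
  by apply: integrableB => //; apply: integrableB.
- under eq_integral do rewrite UVE.
  rewrite integralB//; [|exact: integrableB|exact: integrableB].
  rewrite integralB// integralB// YLm' Ym' Ym integralZl// L1 integral_probability_cst.
  by rewrite !mule1 subee// sube0.
Qed.

(** A vanishing integral of a square forces [r = 1] almost everywhere. The contrapositive makes the
    divergence positive for distinct laws. *)
Lemma same_law_density mu nu (r : S -> R) :
  measurable_fun setT r ->
  (forall f : S -> \bar R, measurable_fun setT f -> (forall x, 0 <= f x) ->
    \int[nu]_x f x = \int[mu]_x (f x * (r x)%:E)) ->
  \int[mu]_x ((r x - 1) ^+ 2)%:E = 0 -> same_law nu mu.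
Proof.
move=> mr nuE r1 A mA.
have m2 : measurable_fun setT (fun x => ((r x - 1) ^+ 2)%:E).
  by apply/measurable_EFinP/measurable_funX; exact: measurable_funB.
have [+ _] := ae_eq_integral_abs mu measurableT m2.
under eq_integral do rewrite gee0_abs ?lee_fin ?sqr_ge0//.
move=> /(_ r1) ae1.
have mI : measurable_fun setT (fun x => (\1_A x : R)%:E) by exact/measurable_EFinP.
have -> : nu A = \int[nu]_x (\1_A x)%:E by rewrite integral_indic// setIT.
have -> : mu A = \int[mu]_x (\1_A x)%:E by rewrite integral_indic// setIT.
rewrite nuE//; apply: ae_eq_integral => //.
- by apply: emeasurable_funM => //; exact/measurable_EFinP.
- case: ae1 => N [mN N0 subN]; exists N; split => // x /= Nx; apply: subN => /= rx1.
  apply: Nx => _; have /eqP := rx1 I; rewrite eqe sqrf_eq0 subr_eq0 => /eqP ->.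
  by rewrite mule1.
Qed.

End density.

(** * Product measures, likelihood ratios and the scalar bound for a sample *)

Section power_integral.
Context d (S : measurableType d) (R : realType).
Implicit Types mu nu : probability S R.

Lemma ge0_integral_power_probability0 mu (g : 0.-tuple S -> \bar R) :
  measurable_fun setT g ->
  \int[power_probability mu 0]_t g t = g [tuple].
Proof. by move=> mg; rewrite integral_dirac// diracT mul1e. Qed.

(** Change of variables along [cons_pair], then Tonelli; this drives the inductions on the sample
    size. *)
Lemma ge0_integral_power_probabilityS mu n (g : n.+1.-tuple S -> \bar R) :
  measurable_fun setT g -> (forall t, 0 <= g t) ->
  \int[power_probability mu n.+1]_t g t =
  \int[mu]_x \int[power_probability mu n]_t g (cons_pair (x, t)).
Proof.
move=> mg g0; rewrite ge0_integral_distribution// fubini_tonelli1 //.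
- by apply: measurableT_comp => //; exact: measurable_cons_pair.
- by move=> z; exact: g0.
Qed.

(** With [h] the density of [nu], this is the likelihood ratio of the sample; with [h] the squared
    density, it is the square of that ratio. *)
Definition tuple_prod (h : S -> R) n (t : n.-tuple S) : R :=
  (\prod_(i < n) h (tnth t i))%R.

Lemma tuple_prod_cons h n x (t : n.-tuple S) :
  tuple_prod h (cons_pair (x, t)) = (h x * tuple_prod h t)%R.
Proof.
rewrite /tuple_prod big_ord_recl; congr (_ * _)%R.
by apply: eq_bigr => i _; rewrite tnthS.
Qed.

Lemma tuple_prod_ge0 h n (t : n.-tuple S) :
  (forall x, 0 <= h x)%R -> (0 <= tuple_prod h t)%R.
Proof. by move=> h0; apply: prodr_ge0. Qed.

Lemma measurable_tuple_prod h n :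
  measurable_fun setT h -> measurable_fun setT (@tuple_prod h n).
Proof.
move=> mh; apply: measurable_prod => i _.
by apply: measurableT_comp => //; exact: measurable_tnth.
Qed.

Lemma measurable_cons_tuple n (x : S) :
  measurable_fun setT (fun t : n.-tuple S => cons_pair (x, t)).
Proof.
apply: (measurableT_comp (@measurable_cons_pair _ S n)).
exact: measurable_pair1.
Qed.

(** Induction on [n], for all [g] at once: the first coordinate changes law by the density [r], the
    others by the induction hypothesis applied to the sections of [g]. *)
Lemma ge0_integral_power_density mu nu (r : S -> R) :
  measurable_fun setT r -> (forall x, 0 <= r x)%R ->
  (forall f : S -> \bar R, measurable_fun setT f -> (forall x, 0 <= f x) ->
    \int[nu]_x f x = \int[mu]_x (f x * (r x)%:E)) ->
  forall n (g : n.-tuple S -> \bar R),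
  measurable_fun setT g -> (forall t, 0 <= g t) ->
  \int[power_probability nu n]_t g t =
  \int[power_probability mu n]_t (g t * (tuple_prod r t)%:E).
Proof.
move=> mr r0 nuE; elim=> [|n IHn] g mg g0.
  rewrite !ge0_integral_power_probability0//.
    by rewrite /tuple_prod big_ord0 mule1.
  apply: emeasurable_funM => //; apply/measurable_EFinP.
  exact: measurable_tuple_prod.
have mL k : measurable_fun setT (fun t : k.-tuple S => (tuple_prod r t)%:E).
  by apply/measurable_EFinP; exact: measurable_tuple_prod.
have mgc x : measurable_fun setT (fun t : n.-tuple S => g (cons_pair (x, t))).
  by apply: measurableT_comp => //; exact: measurable_cons_tuple.
rewrite !ge0_integral_power_probabilityS//; last 2 first.
- exact: emeasurable_funM mg (mL n.+1).
- by move=> t; rewrite mule_ge0// lee_fin tuple_prod_ge0.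
rewrite nuE; last 2 first.
(* The partial integral over the last [n] coordinates is measurable in the first one, by Tonelli. *)
- apply: (measurable_fun_fubini_tonelli_F (m2 := power_probability nu n)
    (g \o @cons_pair _ S n)).
  + by apply: measurableT_comp => //; exact: measurable_cons_pair.
  + by move=> z; exact: g0.
- by move=> x; exact: integral_ge0.
apply: eq_integral => x _; rewrite IHn// -ge0_integralZr//; last 3 first.
- exact: emeasurable_funM (mgc x) (mL n).
- by move=> t _; rewrite mule_ge0// lee_fin tuple_prod_ge0.
- by rewrite lee_fin.
by apply: eq_integral => t _; rewrite tuple_prod_cons -muleA mulrC EFinM.
Qed.

(** By independence the integral of the product factors, one coordinate at a time. *)
Lemma integral_tuple_prod mu (h : S -> R) (c : R) :
  measurable_fun setT h -> (forall x, 0 <= h x)%R ->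
  \int[mu]_x (h x)%:E = c%:E ->
  forall n, \int[power_probability mu n]_t (tuple_prod h t)%:E = (c ^+ n)%:E.
Proof.
move=> mh h0 hc.
have mL k : measurable_fun setT (fun t : k.-tuple S => (tuple_prod h t)%:E).
  by apply/measurable_EFinP; exact: measurable_tuple_prod.
have L0 k (t : k.-tuple S) : 0 <= (tuple_prod h t)%:E.
  by rewrite lee_fin tuple_prod_ge0.
elim=> [|n IHn].
  by rewrite ge0_integral_power_probability0// /tuple_prod big_ord0.
rewrite ge0_integral_power_probabilityS//.
transitivity (\int[mu]_x ((h x)%:E * (c ^+ n)%:E)).
  apply: eq_integral => x _; rewrite -IHn -ge0_integralZl ?lee_fin//; last first.
    exact: mL.
  by apply: eq_integral => t _; rewrite tuple_prod_cons EFinM.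
rewrite ge0_integralZr//=.
- by rewrite hc -EFinM exprS.
- exact/measurable_EFinP.
- by move=> x _; rewrite lee_fin.
- by rewrite -IHn integral_ge0.
Qed.

Lemma variance_power_ge mu nu n (Y : n.-tuple S -> R) : (1 <= n)%N ->
  ~ same_law nu mu ->
  (power_probability mu n).-integrable setT (EFin \o Y) ->
  (power_probability nu n).-integrable setT (EFin \o Y) ->
  ((fine 'E_(power_probability mu n)[Y] -
    fine 'E_(power_probability nu n)[Y]) ^+ 2)%:E
    / ((quadratic_divergence mu nu + 1) ^+ n - 1) <=
  'V_(power_probability mu n)[Y].
Proof.
move=> n1 Nlaw iY iY'.
have [d_oo|d_fin] := eqVneq (quadratic_divergence mu nu) +oo.
  (* Infinite divergence: the bound is 0 by the convention on the inverse of [+oo]. Here [n >= 1]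
     matters, as a zeroth power would be 1. *)
  suff -> : (quadratic_divergence mu nu + 1) ^+ n - 1 = +oo.
    by rewrite invey mule0 variance_ge0.
  rewrite d_oo; case: n n1 {Y iY iY'} => // n _.
  suff -> : (+oo + 1 : \bar R) ^+ n.+1 = +oo by [].
  by elim: n => // n IHn; rewrite expeS IHn.
have numu : nu `<< mu.
  by move: d_fin; rewrite /quadratic_divergence; case: pselect => // _; rewrite eqxx.
have [r [mr r0 nuE dE]] := density_ex numu.
have mr2 : measurable_fun setT (fun x => ((r x - 1) ^+ 2)%:E).
  by apply/measurable_EFinP/measurable_funX; exact: measurable_funB.
have [D [DE D0]] : exists D : R,
    \int[mu]_x ((r x - 1) ^+ 2)%:E = D%:E /\ (0 < D)%R.
  move: d_fin; rewrite dE.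
  have : 0 <= \int[mu]_x ((r x - 1) ^+ 2)%:E.
    by apply: integral_ge0 => x _; rewrite lee_fin sqr_ge0.
  case E : (\int[mu]_x ((r x - 1) ^+ 2)%:E) => [D| |]// + _.
  rewrite lee_fin le_eqVlt => /predU1P[D0|]; last by exists D.
  (* A zero divergence would make the two laws equal. *)
  by exfalso; apply/Nlaw/(same_law_density mr nuE); rewrite E -D0.
have [ir r1] := density_integral1 mr r0 nuE.
have ir1 : mu.-integrable setT (fun x => (r x - 1)%:E).
  under eq_fun do rewrite EFinB.
  by apply: integrableB => //; exact: finite_measure_integrable_cst.
have r10 : \int[mu]_x (r x - 1)%:E = 0%:E.
  under eq_integral do rewrite EFinB.
  rewrite integralB//; last exact: finite_measure_integrable_cst.
  by rewrite r1 integral_probability_cst subee.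
have ir2 : mu.-integrable setT (fun x => ((r x - 1) ^+ 2)%:E).
  apply/integrableP; split => //.
  under eq_integral do rewrite gee0_abs ?lee_fin ?sqr_ge0//.
  by rewrite DE ltry.
(* Shifting the centred variable [r - 1] by 1 shows that [r ^+ 2] has integral [D + 1]. *)
have [_] := integral_sqrB (-1)%R ir1 r10 ir2 DE.
under eq_integral do rewrite opprK subrK.
rewrite mulr0 subr0 sqrrN expr1n => r2E.
have L1E := integral_tuple_prod mr r0 r1 n.
have mL := @measurable_tuple_prod r n mr.
have L0 (t : n.-tuple S) : (0 <= tuple_prod r t)%R by exact: tuple_prod_ge0.
(* The square of a product is the product of the squares, so the factorization applies to
   [r ^+ 2]. *)
have L2E : \int[power_probability mu n]_t (tuple_prod r t ^+ 2)%:E =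
    ((D + 1) ^+ n)%:E.
  rewrite -(integral_tuple_prod (measurable_funX 2 mr) _ r2E) => [|x].
    by apply: eq_integral => t _; rewrite /tuple_prod prodrXl.
  exact: sqr_ge0.
have iL : (power_probability mu n).-integrable setT
    (fun t => (tuple_prod r t)%:E).
  apply/integrableP; split; first exact/measurable_EFinP.
  under eq_integral do rewrite gee0_abs ?lee_fin//.
  by rewrite L1E ltry.
have iL2 : (power_probability mu n).-integrable setT
    (fun t => (tuple_prod r t ^+ 2)%:E).
  apply/integrableP; split; first exact/measurable_EFinP/measurable_funX.
  under eq_integral do rewrite gee0_abs ?lee_fin ?sqr_ge0//.
  by rewrite L2E ltry.
have [iV Vv] := integral_sqrB 1%R iL L1E iL2 L2E.
(* The factor [1 ^+ n] is the integral of the likelihood ratio, in the form given by the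
   factorization. *)
have vE : ((D + 1) ^+ n - 2 * 1 * 1 ^+ n + 1 ^+ 2 = (D + 1) ^+ n - 1)%R.
  by rewrite !expr1n; ring.
rewrite vE in Vv.
have v0 : (0 < (D + 1) ^+ n - 1)%R.
  by rewrite subr_gt0 exprn_egt1// ?ltrDr// -lt0n.
(* As the denominator is nonzero, the extended inverse is the real one. *)
rewrite dE DE -EFinD -EFin_expe -EFinB inver gt_eqF// -EFinM.
apply: variance_ge Vv v0 iY iY' => //.
exact: ge0_integral_power_density.
Qed.

End power_integral.

(** * Reduction of vector estimators to scalar ones *)

Lemma integrable_mulmx_coord d (S : measurableType d) (R : realType)
    (Q : probability S R) q (a : 'cV[R]_q) (T : S -> 'cV[R]_q) (m : 'cV[R]_q) :
  (forall i : 'I_q, Q.-integrable setT (fun x => (T x i ord0)%:E) /\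
    \int[Q]_x (T x i ord0)%:E = (m i ord0)%:E) ->
  Q.-integrable setT (fun x => ((a^T *m T x)%R ord0 ord0)%:E) /\
  \int[Q]_x ((a^T *m T x)%R ord0 ord0)%:E = ((a^T *m m)%R ord0 ord0)%:E.
Proof.
move=> TQ.
have iT i := integrableZl measurableT (a i ord0) (TQ i).1.
have -> : (fun x => ((a^T *m T x)%R ord0 ord0)%:E) =
    (fun x => \sum_(i < q) (a i ord0)%:E * (T x i ord0)%:E).
  apply/funext => x; rewrite mxE -sumEFin.
  by apply: eq_bigr => i _; rewrite mxE EFinM.
split; first exact: integrable_sum.
rewrite integral_sum// mxE -sumEFin; apply: eq_bigr => i _.
by rewrite integralZl ?(TQ i).1// (TQ i).2 mxE EFinM.
Qed.

Unset Implicit Arguments.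

Theorem theorem2p1 (R : realType) (p q n : nat) (n_ge1 : (1 <= n)%N)
  (X : set 'cV[R]_p) (oX : open X) (X0 : X !=set0)
  (P : set (probability (borel (nonempty_subspace X0)) R))
  (mu : probability (borel (nonempty_subspace X0)) R) (Pmu : P mu)
  (H : set 'cV[R]_q) (psi : {fun P >-> H})
  (T : n.-tuple (borel (nonempty_subspace X0)) -> 'cV[R]_q)
  (mT : is_estimator T) (uT : unbiased P psi T) :
  forall nu, P nu -> ~ same_law nu mu -> forall a : 'cV[R]_q,
    'V_(power_probability mu n)[fun x => (a^T *m T x)%R ord0 ord0] >=
    ((((a^T *m psi mu)%R ord0 ord0 - (a^T *m psi nu)%R ord0 ord0) ^+ 2)%R)%:E
      / ((quadratic_divergence mu nu + 1) ^+ n - 1).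
Proof.
move=> nu Pnu Nlaw a.
(* For fixed [a], the scalar bound applies to the statistic [a^T *m T], whose means under the two
   sample laws are given by unbiasedness at [mu] and at [nu]. *)
have [imu Emu] := integrable_mulmx_coord a (uT mu Pmu).
have [inu Enu] := integrable_mulmx_coord a (uT nu Pnu).
have := variance_power_ge n_ge1 Nlaw imu inu.
by rewrite expectation.unlock Emu Enu.
Qed.
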